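(* Let $\mathbb{T}$ be a time scale, unbounded above, with bounded graininess, i.e. $\mu_{\infty}:=\sup_{t\in\mathbb{T}}\mu(t)<\infty$, and let $t_0\in\mathbb{T}$. Then for every $\alpha\in\mathbb{R}$ there exist real constants $c_1,c_2>0$ such that $$c_1\int_{t_0}^{\infty}e^{\alpha t}\,dt\ \le\ \int_{t_0}^{\infty}e^{\alpha t}\,\Delta t\ \le\ c_2\int_{t_0}^{\infty}e^{\alpha t}\,dt .$$
   Context: A time scale $\mathbb{T}$ is a nonempty closed subset of $\mathbb{R}$. For $t\in\mathbb{T}$ the forward jump is $\sigma(t)=\inf\{s\in\mathbb{T}:s>t\}$ and the graininess is $\mu(t)=\sigma(t)-t\ge0$. The delta integral $\int_a^b f(t)\,\Delta t$ is the time scale integral; equivalently it is the Lebesgue integral of $f$ over $[a,b)\cap\mathbb{T}$ plus $\sum \mu(t)f(t)$ over the points $t\in[a,b)\cap\mathbb{T}$ with $\mu(t)>0$. The improper integrals of the positive function $e^{\alpha t}$ are understood as elements of $[0,\infty]$. *)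

(* Defs.v *)
From HB Require Import structures.
From mathcomp Require Import all_boot all_order all_algebra.
From mathcomp Require Import all_classical all_reals all_analysis.

Set Implicit Arguments.
Unset Strict Implicit.
Unset Printing Implicit Defensive.

Import Order.TTheory GRing.Theory Num.Theory.
Import numFieldNormedType.Exports.
Local Open Scope classical_set_scope.
Local Open Scope ring_scope.

Section TimeScale.
Context {R : realType}.
Implicit Types (T : set R) (f : R -> R) (a b t : R).

Definition time_scale T : Prop := T !=set0 /\ closed T.

(* [inf] of an empty set is 0, so [sigma T t] is the forward jump only when
   some point of [T] lies to the right of [t], which is always the case when
   [T] is unbounded above. *)
Definition sigma T t : R := inf [set s | T s /\ t < s].

Definition graininess T t : R := sigma T t - t.

Definition mu_infty T : \bar R :=
  ereal_sup [set (graininess T t)%:E | t in T].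

Definition right_scattered T : set R := [set t | T t /\ 0 < graininess T t].

(* Lebesgue integral over the points of [T] in [a, b), plus the jumps.
   [esum] is a supremum of finite sums, meaningful for nonnegative families
   only, hence the splitting into positive and negative parts. *)
Definition delta_integral T f a b : \bar R :=
  let S := `[a, b[%classic `&` right_scattered T in
  let jump t := (graininess T t * f t)%:E in
  (\int[lebesgue_measure]_(t in `[a, b[%classic `&` T) (f t)%:E
   + (\esum_(t in S) jump^\+ t - \esum_(t in S) jump^\- t))%E.

(* The upper bound tends to infinity along the points of [T]. *)
Definition improper_delta_integral T f a : \bar R :=
  lim (delta_integral T f a b @[b --> within T (pinfty_nbhs R)]).

End TimeScale.

(* Main.v *)
Require Import Defs.
From HB Require Import structures.
From mathcomp Require Import all_boot all_order all_algebra.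
From mathcomp Require Import all_classical all_reals all_analysis.
From mathcomp Require Import measurable_realfun.

(** Since [T] is closed and unbounded above, every point of [[t0, +oo[] outside
    [T] lies in exactly one gap []t, sigma T t[] with [t] a right-scattered
    point of [T] ([notin_gap], [trivIset_gap]).  There are countably many gaps,
    so for [a], [b] in [T] the Lebesgue integral of [f >= 0] over [[a, b[] is
    its integral over the points of [T] plus the sum of its integrals over the
    gaps ([integral_gap_decomposition]).  The delta integral has the same first
    term, and in the sum it replaces the integral of [f] over a gap by
    [graininess T t * f t], the integral over that gap of the constant [f t].
    If [f] varies by at most a factor [C] across each gap, the two integrals
    over [[a, b[] therefore differ by at most the factor [C]
    ([delta_integral_le], [delta_integral_ge]).

    The delta integral of a nonnegative function is nondecreasing in its upper
    bound, so the improper integral is a supremum ([improper_delta_integralE])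
    and the two inequalities pass to the limit.  For [f t = expR (alpha * t)]
    and graininess at most [M], the constant [C = expR (`|alpha| * M)] works,
    whatever the sign of [alpha] and whether or not the integrals converge. *)

Set Implicit Arguments.
Unset Strict Implicit.
Unset Printing Implicit Defensive.

Import Order.TTheory GRing.Theory Num.Theory.
Import numFieldNormedType.Exports.
Local Open Scope classical_set_scope.
Local Open Scope ring_scope.

(** * Gaps of a time scale *)

Lemma sigma_ge {R : realType} {T : set R} (hunb : ~ has_ubound T) (t : R) :
  t <= sigma T t.
Proof.
have /has_ubPn/(_ t)[s Ts ts] := hunb.
by apply: lb_le_inf => [|u [_ /ltW]//]; exists s.
Qed.

Lemma sigma_le {R : realType} {T : set R} (t s : R) :
  T s -> t < s -> sigma T t <= s.
Proof. by move=> Ts ts; apply: ge_inf => //; exists t => u [_ /ltW]. Qed.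

Lemma gap_notin {R : realType} {T : set R} (t x : R) :
  t < x -> x < sigma T t -> ~ T x.
Proof. by move=> tx xs Tx; move: xs; rewrite ltNge sigma_le. Qed.

(** The left end of the gap around [x] is the last point of [T] before [x]: it
    is in [T] because [T] is closed, and for the same reason a neighbourhood of
    [x] avoids [T], which pushes the next point of [T] strictly beyond [x]. *)
Lemma notin_gap {R : realType} {T : set R} (cT : closed T)
    (hunb : ~ has_ubound T) (t0 x : R) :
  T t0 -> t0 <= x -> ~ T x ->
  exists t, [/\ T t, t0 <= t, t < x & x < sigma T t].
Proof.
move=> Tt0 t0x nTx; set A := T `&` [set s | s <= x].
have A0 : A !=set0 by exists t0.
have ubA : has_ubound A by exists x => s [].
have TA : T (sup A).
  apply: cT; apply: (closureS (A := A)) => [s []//|].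
  exact: closure_sup.
have Ax : sup A <= x by apply: ge_sup => // s [].
exists (sup A); split => //.
- exact: ub_le_sup.
- by rewrite lt_neqAle Ax andbT; apply/eqP => E; apply: nTx; rewrite -E.
have /nbhs_ballP[_/posnumP[e] eT] : nbhs x (~` T).
  by apply: open_nbhs_nbhs; split => //; exact: closed_openC.
apply: (@lt_le_trans _ _ (x + e%:num)); first by rewrite ltrDl.
have /has_ubPn/(_ (sup A))[s Ts ts] := hunb.
apply: lb_le_inf; first by exists s.
move=> u [Tu Au]; rewrite leNgt; apply/negP => uxe.
have xu : x < u.
  by rewrite ltNge; apply/negP => ux; move: Au; rewrite ltNge ub_le_sup.
apply: (eT u) => //; rewrite /ball /= ltr_distlC uxe andbT.
by rewrite ltrBlDr (lt_trans xu)// ltrDl.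
Qed.

(** If [i < j] are both in [T], the gap at [i] stops at [j] at the latest. *)
Lemma trivIset_gap {R : realType} {T : set R} :
  trivIset T (fun t => `]t, sigma T t[%classic).
Proof.
apply/trivIsetP.
suff H i j : T i -> T j -> i < j ->
    `]i, sigma T i[ `&` `]j, sigma T j[ = set0 :> set R.
  move=> i j Ti Tj; rewrite neq_lt => /orP[ij|ji]; first exact: H.
  by rewrite setIC; exact: H.
move=> Ti Tj ij; apply/seteqP; split => // x /=.
rewrite !in_itv/= => -[/andP[_ xi] /andP[jx _]].
by have := lt_le_trans xi (sigma_le Tj ij); rewrite ltNge (ltW jx).
Qed.

Lemma countable_right_scattered {R : realType} {T : set R} :
  countable (right_scattered T).
Proof.
(* The countability lemma for disjoint open sets wants them nonempty at every
   index, whereas the gap at a right-dense point is empty. *)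
pose B t := if 0 < graininess T t then `]t, sigma T t[%classic else setT.
apply: (@separated_open_countable _ _ B).
- by move=> t; rewrite /B; case: ifP => _; [exact: itv_open|exact: openT].
- move=> t; rewrite /B; case: ifP => [|_]; last by exists 0.
  rewrite subr_gt0 => tS; exists ((t + sigma T t) / 2).
  by rewrite /= in_itv/= !midf_lt.
- move=> i j [Ti i0] [Tj j0]; rewrite /B i0 j0 => H.
  exact: trivIset_gap H.
Qed.

Local Open Scope ereal_scope.

(** * Integrals and sums over countable families *)

(** Countable additivity of the integral for an arbitrary countable index set:
    the gaps are indexed by points of [T], not by [nat]. *)
Lemma ge0_integral_countable_bigcup d (X : measurableType d) (R : realType)
    (mu : {measure set X -> \bar R}) (I : choiceType) (S : set I)
    (A : I -> set X) (f : X -> \bar R) :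
  countable S -> (forall i, measurable (A i)) -> trivIset S A ->
  measurable_fun setT f -> (forall x, 0 <= f x) ->
  \int[mu]_(x in \bigcup_(i in S) A i) f x =
  \esum_(i in S) \int[mu]_(x in A i) f x.
Proof.
move=> /countable_injP[g ginj] mA tA mf f0.
(* By injectivity of [g] on [S], the union [F n] is the single set [A i] with
   [g i = n], or empty when [n] is not a value of [g]. *)
pose F n := \bigcup_(i in S `&` [set i | g i = n]) A i.
have FA i : S i -> F (g i) = A i.
  move=> Si; apply/seteqP; split => [x [j [Sj gj] Ajx]|x Ax]; last by exists i.
  by rewrite -(ginj j i) ?inE.
have F0 n : ~ (g @` S) n -> F n = set0.
  by move=> gn; apply/seteqP; split => // x [j [Sj gj] _]; apply: gn; exists j.
have mF n : measurable (F n).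
  have [[i Si <-]|/F0->//] := pselect ((g @` S) n).
  by rewrite FA.
have tF : trivIset setT F.
  move=> m n _ _ [x [[i [Si <-] Ax] [j [Sj <-] Bx]]].
  by congr g; apply: tA => //; exists x.
have -> : \bigcup_(i in S) A i = \bigcup_n F n.
  apply/seteqP; split => [x [i Si Ax]|x [n _ [i [Si _] Ax]]]; last by exists i.
  by exists (g i) => //; exists i.
rewrite ge0_integral_bigcup//; last exact: measurable_funTS.
rewrite nneseries_esumT; last by move=> n; exact: integral_ge0.
transitivity (\esum_(n in g @` S) \int[mu]_(x in F n) f x).
  rewrite [RHS]esum_mkcond; apply: eq_esum => n _; case: ifPn => // /negP gn.
  by rewrite F0 ?integral_set0// => /mem_set.
rewrite esum_image; last exact: ginj.
by apply: eq_esum => i Si; rewrite FA.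
Qed.

Lemma ge0_esumZ_le (R : realType) (I : choiceType) (S : set I)
    (a : I -> \bar R) (c : R) :
  (0 <= c)%R -> (forall i, S i -> 0 <= a i) ->
  \esum_(i in S) (c%:E * a i) <= c%:E * \esum_(i in S) a i.
Proof.
move=> c0 a0; apply: ge_ereal_sup => _ [X [finX XS] <-].
rewrite !fsbig_finite//= big_seq -ge0_sume_distrr; last first.
  by move=> i; rewrite in_fset_set// inE => /XS /a0.
rewrite -big_seq lee_wpmul2l ?lee_fin// -fsbig_finite//.
by apply: esum_ge; exists X.
Qed.

(** * Delta integral against Lebesgue integral *)

Section comparison.
Context {R : realType} {T : set R} {f : R -> R}.
Hypothesis cT : closed T.
Hypothesis hunb : ~ has_ubound T.
Hypothesis f0 : forall x, (0 <= f x)%R.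
Hypothesis mf : measurable_fun setT f.
Local Notation leb := (@lebesgue_measure R).
Implicit Types a b : R.

Let mEf D : measurable_fun D (EFin \o f).
Proof. by apply/measurable_EFinP; exact: measurable_funTS. Qed.

Let mT : measurable T. Proof. exact: closed_measurable. Qed.

(** The negative part of the jumps vanishes, which leaves a single sum. *)
Lemma ge0_delta_integralE a b :
  delta_integral T f a b = \int[leb]_(t in `[a, b[ `&` T) (f t)%:E
    + \esum_(t in `[a, b[ `&` right_scattered T) (graininess T t * f t)%:E.
Proof.
have j0 t : 0 <= (graininess T t * f t)%:E.
  by rewrite lee_fin mulr_ge0// subr_ge0 sigma_ge.
rewrite /delta_integral; congr (_ + _).
rewrite [X in _ - X]esum1; last first.
  by move=> t _; rewrite funenegE; apply/max_idPr; rewrite leeNl oppe0.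
by rewrite sube0; apply: eq_esum => t _; rewrite funeposE; exact/max_idPl.
Qed.

Lemma nondecreasing_delta_integral a :
  {homo delta_integral T f a : b b' / (b <= b')%R >-> b <= b'}.
Proof.
move=> b b' bb'; have sub : `[a, b[%classic `<=` `[a, b'[%classic.
  by apply: subset_itvl; rewrite bnd_simp.
rewrite !ge0_delta_integralE; apply: leeD.
- apply: ge0_subset_integral => //.
  + exact: measurableI.
  + exact: measurableI.
  + exact: mEf.
  + by move=> x _; rewrite lee_fin.
  + exact: setSI.
- apply: ereal_sup_le; apply: image_subset => X [finX XS].
  by split => // x /XS[xab ?]; split => //; exact: sub.
Qed.

(** With [b] in [T] no gap that starts before [b] can stick out of
    [[a, b[]. *)
Lemma integral_gap_decomposition a b : T a -> T b ->
  \int[leb]_(t in `[a, b[) (f t)%:E = \int[leb]_(t in `[a, b[ `&` T) (f t)%:E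
   + \esum_(t in `[a, b[ `&` right_scattered T)
       \int[leb]_(x in `]t, sigma T t[) (f x)%:E.
Proof.
move=> Ta Tb; set S := `[a, b[ `&` right_scattered T.
have SsubT : S `<=` T by move=> t [_ []].
have tS : trivIset S (fun t => `]t, sigma T t[%classic).
  exact: sub_trivIset trivIset_gap.
have E : `[a, b[%classic =
    (`[a, b[ `&` T) `|` \bigcup_(t in S) `]t, sigma T t[%classic.
  apply/seteqP; split => [x|x [[]//|[t [] + [Tt _]]]]; last first.
    rewrite /= !in_itv/= => /andP[at_ tb] /andP[tx xs]; apply/andP; split.
      by rewrite (le_trans at_)// ltW.
    exact: lt_le_trans xs (sigma_le Tb tb).
  move=> xab; have [Tx|nTx] := pselect (T x); [by left|right].
  move: xab; rewrite /= in_itv/= => /andP[ax xb].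
  have [t [Tt at_ tx xs]] := notin_gap cT hunb Ta ax nTx.
  exists t; last by rewrite /= in_itv/= tx xs.
  split; first by rewrite /= in_itv/= at_ (lt_trans tx).
  by split => //; rewrite subr_gt0 (lt_trans tx).
have cS : countable S.
  apply: sub_countable (countable_right_scattered (T := T)).
  by apply: subset_card_le; exact: subIsetr.
rewrite -ge0_integral_countable_bigcup//; last exact: mEf.
rewrite [in LHS]E ge0_integral_setU//.
- exact: measurableI.
- by apply: open_measurable; apply: bigcup_open => t _; exact: itv_open.
- exact: mEf.
- by move=> x _; rewrite lee_fin.
- apply/disj_setPS => x [[_ Tx] [t _]].
  by rewrite /= in_itv/= => /andP[tx xs]; exact: gap_notin xs Tx.
Qed.

Variable C : R.
Hypothesis C1 : (1 <= C)%R.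
Hypothesis fC : forall t x, T t -> (t < x)%R -> (x < sigma T t)%R ->
  (f x <= C * f t)%R /\ (f t <= C * f x)%R.

Let C0 : (0 <= C)%R. Proof. exact: le_trans C1. Qed.

Let integral_gap_cst t (k : R) :
  \int[leb]_(x in `]t, sigma T t[) k%:E = (graininess T t * k)%:E.
Proof.
rewrite integral_cst//= lebesgue_measure_itv/= lte_fin.
case: ltgtP (sigma_ge hunb t) => // [_ _|E _].
  by rewrite -EFinB -EFinM mulrC.
by rewrite /graininess -E subrr mul0r mule0.
Qed.

Lemma gap_integral_le t : T t ->
  \int[leb]_(x in `]t, sigma T t[) (f x)%:E
    <= C%:E * (graininess T t * f t)%:E.
Proof.
move=> Tt; rewrite -EFinM mulrCA -integral_gap_cst.
apply: ge0_le_integral => //.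
- by move=> x _; rewrite lee_fin.
- exact: mEf.
- by move=> x /=; rewrite in_itv/= lee_fin => /andP[tx /(fC Tt tx)[]].
Qed.

Lemma gap_integral_ge t : T t ->
  (graininess T t * f t)%:E
    <= C%:E * \int[leb]_(x in `]t, sigma T t[) (f x)%:E.
Proof.
move=> Tt; rewrite -integral_gap_cst -ge0_integralZl_EFin//; last 2 first.
- by move=> x _; rewrite lee_fin.
- exact: mEf.
apply: ge0_le_integral => //.
- by move=> x _; rewrite lee_fin.
- by apply/measurable_EFinP/measurable_funM => //; exact: measurable_funTS.
- move=> x /=; rewrite in_itv/= -EFinM lee_fin.
  by move=> /andP[tx /(fC Tt tx)[]].
Qed.

Let le_scale (x : \bar R) : 0 <= x -> x <= C%:E * x.
Proof. by move=> x0; rewrite lee_pemull// lee_fin. Qed.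

Lemma delta_integral_le a b : T a -> T b ->
  delta_integral T f a b <= C%:E * \int[leb]_(t in `[a, b[) (f t)%:E.
Proof.
move=> Ta Tb; rewrite ge0_delta_integralE integral_gap_decomposition//.
have i0 D : 0 <= \int[leb]_(t in D) (f t)%:E.
  by apply: integral_ge0 => x _; rewrite lee_fin.
rewrite ge0_muleDr ?esum_ge0//; apply: leeD; first exact: le_scale.
apply: (le_trans _ (ge0_esumZ_le C0 _)) => //.
by apply: le_esum => t [_ [Tt _]]; exact: gap_integral_ge.
Qed.

Lemma delta_integral_ge a b : T a -> T b ->
  \int[leb]_(t in `[a, b[) (f t)%:E <= C%:E * delta_integral T f a b.
Proof.
move=> Ta Tb; rewrite ge0_delta_integralE integral_gap_decomposition//.
have i0 D : 0 <= \int[leb]_(t in D) (f t)%:E.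
  by apply: integral_ge0 => x _; rewrite lee_fin.
have j0 t : 0 <= (graininess T t * f t)%:E.
  by rewrite lee_fin mulr_ge0// subr_ge0 sigma_ge.
rewrite ge0_muleDr ?esum_ge0//; apply: leeD; first exact: le_scale.
apply: (le_trans _ (ge0_esumZ_le C0 _)) => //.
by apply: le_esum => t [_ [Tt _]]; exact: gap_integral_le.
Qed.

(** Monotonicity gives the limit along all reals; restricting to [T] does not
    change it, and the restricted filter is proper because [T] is unbounded. *)
Lemma improper_delta_integralE a :
  improper_delta_integral T f a = ereal_sup (range (delta_integral T f a)).
Proof.
have PF : ProperFilter (within T (pinfty_nbhs R)).
  apply: Build_ProperFilter_ex => B [M [_ MB]].
  by have /has_ubPn/(_ M)[s Ts Ms] := hunb; exists s; exact: MB.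
apply: cvg_lim; first exact: ereal_hausdorff.
apply: cvg_within_filter; apply: nondecreasing_cvge.
exact: nondecreasing_delta_integral.
Qed.

(** A supremum over all real upper bounds may be taken over those in [T], where
    the comparison on bounded intervals applies. *)
Lemma improper_delta_integral_le a : T a ->
  improper_delta_integral T f a <= C%:E * \int[leb]_(t in `[a, +oo[) (f t)%:E.
Proof.
move=> Ta; rewrite improper_delta_integralE.
apply: ge_ereal_sup => _ [b _ <-].
have /has_ubPn/(_ b)[s Ts bs] := hunb.
apply: le_trans (nondecreasing_delta_integral a (ltW bs)) _.
apply: le_trans (delta_integral_le Ta Ts) _.
rewrite lee_wpmul2l ?lee_fin//; apply: ge0_subset_integral => //.
- exact: mEf.
- by move=> x _; rewrite lee_fin.
- by apply: subset_itvl.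
Qed.

(** The Lebesgue integral over [[a, +oo[] is the limit of the integrals over
    [[a, n[], each of which is dominated by moving [n] up to a point of [T]. *)
Lemma improper_delta_integral_ge a : T a ->
  \int[leb]_(t in `[a, +oo[) (f t)%:E <= C%:E * improper_delta_integral T f a.
Proof.
move=> Ta; rewrite improper_delta_integralE.
have E : `[a, +oo[%classic = \bigcup_n `[a, n%:R[%classic :> set R.
  apply/seteqP; split => [x|x [n _]]; last first.
    by rewrite /= !in_itv/= andbT => /andP[].
  rewrite /= in_itv/= andbT => ax; exists (Num.truncn x).+1 => //.
  by rewrite /= in_itv/= ax truncnS_gt.
rewrite E.
have nd : nondecreasing_seq (fun n => `[a, n%:R[%classic : set R).
  move=> m n mn; rewrite subsetEset; apply: subset_itvl.
  by rewrite bnd_simp ler_nat.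
have cv : \int[leb]_(x in `[a, n%:R[) (f x)%:E @[n --> \oo] -->
    \int[leb]_(x in \bigcup_n `[a, n%:R[%classic) (f x)%:E.
  apply: ge0_nondecreasing_set_cvg_integral => //.
  - by move=> n; exact: mEf.
  - by move=> n x _; rewrite lee_fin.
rewrite -(cvg_lim _ cv)//.
apply: lime_le; first exact: (cvgP _ cv).
apply: nearW => n; have /has_ubPn/(_ n%:R)[s Ts ns] := hunb.
apply: (@le_trans _ _ (\int[leb]_(t in `[a, s[) (f t)%:E)).
  apply: ge0_subset_integral => //.
  - exact: mEf.
  - by move=> x _; rewrite lee_fin.
  - by apply: subset_itvl; rewrite bnd_simp ltW.
apply: le_trans (delta_integral_ge Ta Ts) _.
by rewrite lee_wpmul2l ?lee_fin//; apply: ereal_sup_ubound; exists s.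
Qed.

End comparison.

Local Close Scope ereal_scope.

(** * The exponential function *)

Lemma graininess_bounded {R : realType} {T : set R} :
  (mu_infty T < +oo)%E -> exists M, forall t, T t -> graininess T t <= M.
Proof.
move=> hmu; have le_mu t : T t -> ((graininess T t)%:E <= mu_infty T)%E.
  by move=> Tt; apply: ereal_sup_ubound; exists t.
case: (mu_infty T) hmu le_mu => [M| |]// _ le_mu.
  by exists M => t /le_mu; rewrite lee_fin.
by exists 0 => t /le_mu; rewrite leeNy_eq.
Qed.

Lemma expR_comparison {R : realType} (alpha M x y : R) : `|x - y| <= M ->
  expR (alpha * x) <= expR (`|alpha| * M) * expR (alpha * y).
Proof.
move=> xyM; rewrite -expRD ler_expR -lerBlDr -mulrBr.
by rewrite (le_trans (ler_norm _))// normrM ler_wpM2l.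
Qed.

Unset Implicit Arguments.

Theorem lemma5p2 (R : realType) (T : set R) (t0 : R)
    (hT : time_scale T) (hunb : ~ has_ubound T)
    (hmu : (mu_infty T < +oo)%E) (ht0 : T t0) (alpha : R) :
  exists c1 c2 : R, [/\ 0 < c1, 0 < c2,
    (c1%:E * \int[lebesgue_measure]_(t in `[t0, +oo[) (expR (alpha * t))%:E
       <= improper_delta_integral T (fun t => expR (alpha * t)) t0)%E
  & (improper_delta_integral T (fun t => expR (alpha * t)) t0
       <= c2%:E * \int[lebesgue_measure]_(t in `[t0, +oo[)
                     (expR (alpha * t))%:E)%E].
Proof.
have [_ cT] := hT; have [M grM] := graininess_bounded hmu.
have M0 : 0 <= M by apply: le_trans (grM _ ht0); rewrite subr_ge0 sigma_ge.
pose f t := expR (alpha * t); pose C := expR (`|alpha| * M).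
have C0 : 0 < C by exact: expR_gt0.
have C1 : 1 <= C by rewrite -expR0 ler_expR mulr_ge0.
have f0 x : 0 <= f x by exact: expR_ge0.
have mf : measurable_fun setT f.
  by apply: measurableT_comp => //; exact: measurable_funM.
have fC t x : T t -> t < x -> x < sigma T t ->
    f x <= C * f t /\ f t <= C * f x.
  move=> Tt tx xs; have xtM : `|x - t| <= M.
    rewrite gtr0_norm ?subr_gt0//; apply: le_trans (grM _ Tt).
    by rewrite lerB// ltW.
  by split; apply: expR_comparison => //; rewrite distrC.
exists C^-1, C; split => //; first by rewrite invr_gt0.
  rewrite lee_pdivrMl//.
  exact: (improper_delta_integral_ge cT hunb f0 mf C1 fC).
exact: (improper_delta_integral_le cT hunb f0 mf C1 fC).
Qed.
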